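(* Let $(G,* )$ and $(G',\cdot)$ be groupoids and let $f:G\to G'$ be a half-isomorphism. Then the following statements are equivalent: (a) $f$ is special. (b) $\{f(x*y),f(y*x)\}=\{f(x)\cdot f(y),\,f(y)\cdot f(x)\}$ for any $x,y\in G$. (c) For all $x,y\in G$ such that $x*y=y*x$, we have $f(x)\cdot f(y)=f(y)\cdot f(x)$. (d) The map $\psi_{(G,G')}:K(G')\to K(G)$, $(x,y)\mapsto (f^{-1}(x),f^{-1}(y))$, is a bijection.
   Context: A groupoid is a nonempty set with a binary operation. For groupoids $(G,* )$ and $(G',\cdot)$, a bijection $f:G\to G'$ is a half-isomorphism if $f(x*y)\in\{f(x)\cdot f(y),f(y)\cdot f(x)\}$ for all $x,y\in G$. A half-isomorphism $f$ is special if the inverse map $f^{-1}:G'\to G$ is also a half-isomorphism. For a groupoid $G$, $K(G)=\{(x,y)\in G\times G\mid xy=yx\}$, the products being taken in $G$. For any half-isomorphism $f:G\to G'$, $(x,y)\in K(G')$ implies $(f^{-1}(x),f^{-1}(y))\in K(G)$, so $\psi_{(G,G')}$ is a well-defined map. *)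

(* Defs.v *)
From mathcomp Require Import all_boot.
From mathcomp Require Import boolp classical_sets.

Set Implicit Arguments.
Unset Strict Implicit.
Unset Printing Implicit Defensive.

Local Open Scope group_scope.
Local Open Scope classical_set_scope.

Lemma bijective_preimage (T T' : Type) (f : T -> T') :
  bijective f -> forall y, exists x, f x = y.
Proof. by case=> g _ gK y; exists (g y). Qed.

(* [bijective f] lives in [Prop], so the inverse function is extracted by
   choice; the preimage being unique, the chosen value is the only possible one
   (see [inverseK] and [inverseVK]). *)
Definition inverse (T T' : Type) (f : T -> T') (bij_f : bijective f) : T' -> T :=
  fun y => sval (cid (bijective_preimage bij_f y)).

Lemma inverseVK (T T' : Type) (f : T -> T') (bij_f : bijective f) :
  cancel (inverse bij_f) f.
Proof. by move=> y; rewrite /inverse; case: cid. Qed.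

Lemma inverseK (T T' : Type) (f : T -> T') (bij_f : bijective f) :
  cancel f (inverse bij_f).
Proof. by move=> x; apply: (bij_inj bij_f); rewrite inverseVK. Qed.

(* A groupoid is a [magmaType] whose carrier is nonempty; nonemptiness is not
   part of [magmaType] and is assumed separately, as [inhabited G]. *)
Record half_isomorphism (G G' : magmaType) (f : G -> G') : Prop :=
  HalfIsomorphism {
    half_isomorphism_bij : bijective f;
    half_isomorphism_mul :
      forall x y : G, [set f x * f y; f y * f x] (f (x * y))
  }.

Definition half_isomorphism_inv (G G' : magmaType) (f : G -> G')
    (half_f : half_isomorphism f) : G' -> G :=
  inverse (half_isomorphism_bij half_f).

Definition special (G G' : magmaType) (f : G -> G')
    (half_f : half_isomorphism f) : Prop :=
  half_isomorphism (half_isomorphism_inv half_f).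

Definition K (G : magmaType) : set (G * G) := [set p | commute p.1 p.2].
Arguments K : clear implicits.

Lemma half_isomorphism_inv_K (G G' : magmaType) (f : G -> G')
    (half_f : half_isomorphism f) (p : K G') :
  (half_isomorphism_inv half_f (val p).1, half_isomorphism_inv half_f (val p).2)
    \in K G.
Proof.
case: p => -[x y] /= /set_mem; rewrite /K /commute /= => xy.
apply/mem_set; rewrite /commute /=; set g := half_isomorphism_inv half_f.
have gK z : f (g z) = z by exact: inverseVK.
apply: (bij_inj (half_isomorphism_bij half_f)).
have := half_isomorphism_mul half_f (g x) (g y).
have := half_isomorphism_mul half_f (g y) (g x).
by rewrite /= !gK xy => -[] -> [] ->.
Qed.

Definition psi (G G' : magmaType) (f : G -> G')
    (half_f : half_isomorphism f) (p : K G') : K G :=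
  exist (fun q => q \in K G) _ (half_isomorphism_inv_K half_f p).

(* Main.v *)
(* A half-isomorphism [f] gives [{f (x * y), f (y * x)} `<=` {f x * f y, f y * f x}]
   for free, and [f] is special exactly when the reverse inclusion always holds.
   If [x * y != y * x], the reverse inclusion is automatic, the left-hand side
   having two elements; so only commuting pairs matter, and for those it says
   that [f x] and [f y] commute. Since [psi] is always injective, this is in turn
   the surjectivity of [psi]. *)
Require Import Defs.
From mathcomp Require Import all_boot.
From mathcomp Require Import boolp classical_sets.

Local Open Scope group_scope.
Local Open Scope classical_set_scope.

Section HalfIsomorphism.
Variables (G G' : magmaType) (f : G -> G') (half_f : half_isomorphism f).
Local Notation g := (half_isomorphism_inv half_f).

Lemma half_isomorphism_invVK : cancel g f.
Proof. exact: inverseVK. Qed.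

Lemma half_isomorphism_invK : cancel f g.
Proof. exact: inverseK. Qed.

(** The inverse of a bijection is a bijection, so only the product condition on [g] matters; setting
    [u = f x], [v = f y] and applying [f] frees it of [g]. *)
Lemma specialP :
  special half_f <-> forall x y, [set f (x * y); f (y * x)] (f x * f y).
Proof.
split=> [[_ mulg] x y | mulf].
  have := mulg (f x) (f y); rewrite /= !half_isomorphism_invK.
  by case=> <-; rewrite half_isomorphism_invVK; [left | right].
split=> [|u v]; first exact: Bijective half_isomorphism_invVK half_isomorphism_invK.
have := mulf (g u) (g v); rewrite /= !half_isomorphism_invVK.
by case=> ->; rewrite half_isomorphism_invK; [left | right].
Qed.

Lemma special_eq_set2 : special half_f ->
  forall x y, [set f (x * y); f (y * x)] = [set f x * f y; f y * f x].
Proof.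
move=> /specialP mulf x y; apply/seteqP; split=> z /= [] ->.
- exact: half_isomorphism_mul.
- by rewrite orC; exact: half_isomorphism_mul.
- exact: mulf.
- by rewrite orC; exact: mulf.
Qed.

Lemma commute_special :
  (forall x y, commute x y -> commute (f x) (f y)) -> special half_f.
Proof.
move=> commf; apply/specialP => x y.
have [xy | nxy] := pselect (commute x y).
  have := half_isomorphism_mul half_f x y.
  by rewrite /= -(commf _ _ xy) => -[] ->; left.
(* If [f x * f y] were neither image, both [f (x * y)] and [f (y * x)] would equal [f y * f x],
   against injectivity of [f]. *)
have [fxy | fxy] := half_isomorphism_mul half_f x y; first by left.
have [fyx | fyx] := half_isomorphism_mul half_f y x; last by right.
by case: nxy; apply: (bij_inj (half_isomorphism_bij half_f)); rewrite fxy fyx.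
Qed.

Lemma psi_inj : injective (psi half_f).
Proof.
move=> [[u v] Kp] [[u' v'] Kq] /(congr1 val) [/= eq_u eq_v].
apply: val_inj => /=; congr pair.
  exact: (can_inj half_isomorphism_invVK).
exact: (can_inj half_isomorphism_invVK).
Qed.

Lemma bijective_psiP :
  bijective (psi half_f) <-> forall x y, commute x y -> commute (f x) (f y).
Proof.
split=> [bij_psi x y xy | commf].
  have Kxy : (x, y) \in K G by apply/mem_set.
  (* The preimage of [(x, y)] can only be [(f x, f y)], which therefore lies in [K G']. *)
  have [[[u v] /= Kuv]] := bijective_preimage bij_psi (exist _ (x, y) Kxy).
  move=> /(congr1 val) [/= <- <-].
  by rewrite !half_isomorphism_invVK; exact: (set_mem Kuv).
have Kf (q : K G) : (f (val q).1, f (val q).2) \in K G'.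
  by apply/mem_set; apply: commf; exact: (set_mem (valP q)).
pose phi (q : K G) : K G' := exist (fun p => p \in K G') _ (Kf q).
have phiK : cancel phi (psi half_f).
  by move=> [[x y] Kxy]; apply: val_inj; rewrite /= !half_isomorphism_invK.
(* Since [psi] is injective, its right inverse [phi] is two-sided. *)
by exists phi => //; exact: inj_can_sym phiK psi_inj.
Qed.

End HalfIsomorphism.

Theorem theorem3p2 (G G' : magmaType) (nonempty_G : inhabited G)
    (nonempty_G' : inhabited G') (f : G -> G') (half_f : half_isomorphism f) :
  [<-> special half_f;
       forall x y : G,
         [set f (x * y); f (y * x)] = [set f x * f y; f y * f x];
       forall x y : G, x * y = y * x -> f x * f y = f y * f x;
       bijective (psi half_f)].
Proof.
tfae.
- exact: special_eq_set2.
- move=> eqf x y xy; have := eqf x y; rewrite xy => /seteqP [_ sub].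
  (* The left-hand set has collapsed to the single point [f (y * x)], so both products equal it. *)
  have [->|->] := sub _ (or_introl erefl);
    by have [->|->] := sub _ (or_intror erefl).
- by move=> commf; apply/bijective_psiP.
- by move=> /bijective_psiP; exact: commute_special.
Qed.
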